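(* Let $A_j\in\mathbb R^{N_j\times N_j}$, $j=1,\dots,n$, be Hurwitz matrices, and let $\Delta_{jk}\in\mathbb R^{N_j\times N_k}$, $j,k=1,\dots,n$, with $\Delta_{jj}=0$ for all $j$. Let $A=\mathrm{diag}(A_1,\dots,A_n)$ (block diagonal) and $\Delta=(\Delta_{jk})$ (block matrix). Let $M_j,\lambda_j>0$ be constants such that $\|e^{A_jt}\|\le M_je^{-\lambda_jt}$ for all $t\ge0$, $j=1,\dots,n$. Define $R=(r_{jk})\in\mathbb R_+^{n\times n}$ by $r_{jk}:=\|\Delta_{jk}\|$ and $D:=\mathrm{diag}\big(\tfrac{M_1}{\lambda_1},\dots,\tfrac{M_n}{\lambda_n}\big)\in\mathbb R_+^{n\times n}$. If the spectral radius satisfies $\rho(D\cdot R)<1$, then the system $$\dot x=(A+\Delta)x$$ is globally asymptotically stable.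
   Context: A matrix is Hurwitz if its spectrum is contained in the open left half plane. $\|\cdot\|$ denotes the operator norms induced by fixed vector norms on the spaces $\mathbb R^{N_j}$. $\mathbb R_+=[0,\infty)$. *)

(* Defs.v *)
From HB Require Import structures.
From mathcomp Require Import all_boot all_order all_algebra.
From mathcomp Require Import all_classical all_reals all_analysis.
From mathcomp.real_closed Require Import complex.
Set Implicit Arguments.
Unset Strict Implicit.
Unset Printing Implicit Defensive.
Import Order.TTheory GRing.Theory Num.Theory.
Import numFieldNormedType.Exports.
Local Open Scope classical_set_scope.
Local Open Scope ring_scope.

Definition cmx (R : realType) (m n : nat) (B : 'M[R]_(m, n)) : 'M[R[i]]_(m, n) :=
  map_mx (real_complex R) B.

(* The spectrum of a real matrix is taken in the complex numbers. *)
Definition spectrum (R : realType) (m : nat) (B : 'M[R]_m) : set R[i] :=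
  [set z | eigenvalue (cmx B) z].

Definition hurwitz (R : realType) (m : nat) (B : 'M[R]_m) : Prop :=
  spectrum B `<=` [set z | complex.Re z < 0].

(* [Normc.normc] is the real-valued modulus; the library norm of a complex
   number is itself complex-valued.  The set is finite, and the supremum is 0
   when m = 0. *)
Definition spectral_radius (R : realType) (m : nat) (B : 'M[R]_m) : R :=
  sup [set ComplexField.Normc.normc z | z in spectrum B].

Record vector_norm (R : realType) (m : nat) (nu : 'cV[R]_m -> R) : Prop := {
  vector_norm_triangle : forall x y, nu (x + y) <= nu x + nu y ;
  vector_norm_homogeneous : forall (a : R) x, nu (a *: x) = `|a| * nu x ;
  vector_norm_definite : forall x, nu x = 0 -> x = 0 }.

(* The matrix maps the space normed by [nuin] to the space normed by [nuout]. *)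
Definition operator_norm (R : realType) (p q : nat) (nuin : 'cV[R]_q -> R)
    (nuout : 'cV[R]_p -> R) (B : 'M[R]_(p, q)) : R :=
  sup [set nuout (B *m x) | x in [set x | nuin x <= 1]].

Definition mx_exp (R : realType) (m : nat) (B : 'M[R]_m) : 'M[R]_m :=
  limn (series (fun k : nat => (k`!%:R)^-1 *: B ^+ k)).

(* A solution of x' = f(x) on [0, +oo).  The values of [x] at negative times
   are irrelevant.  For continuous f, continuity at 0 together with the equation
   on (0, +oo) gives the right-hand derivative f (x 0) at 0. *)
Definition solution (R : realType) (m : nat) (f : 'cV[R]_m -> 'cV[R]_m)
    (x : R -> 'cV[R]_m) : Prop :=
  {within `[0, +oo[, continuous x} /\
  forall t : R, 0 < t -> is_derive t 1 x (f (x t)).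

(* Global asymptotic stability of the origin: forward completeness, Lyapunov
   stability and global attractivity.  The library norm on column vectors is the
   max norm; any other norm gives the same notion. *)
Definition globally_asymptotically_stable (R : realType) (m : nat)
    (f : 'cV[R]_m -> 'cV[R]_m) : Prop :=
  [/\ forall x0 : 'cV[R]_m, exists2 x, solution f x & x 0 = x0,
      forall e : R, 0 < e -> exists2 d : R, 0 < d &
        forall x, solution f x -> `|x 0| < d ->
          forall t : R, 0 <= t -> `|x t| < e
    & forall x, solution f x -> x t @[t --> +oo] --> (0 : 'cV[R]_m)].

(* Main.v *)
Require Import Defs.
From HB Require Import structures.
From mathcomp Require Import all_boot all_order all_algebra.
From mathcomp Require Import all_classical all_reals all_analysis.
From mathcomp.real_closed Require Import complex.
From mathcomp Require Import ring lra.
Set Implicit Arguments.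
Unset Strict Implicit.
Unset Printing Implicit Defensive.
Import Order.TTheory GRing.Theory Num.Theory.
Import numFieldNormedType.Exports.
Local Open Scope classical_set_scope.
Local Open Scope ring_scope.

(** A small-gain argument.  Each decoupled block decays at the rate lambda_j, up
    to the constant M_j, and the coupling is weak enough, in the sense that the
    nonnegative gain matrix P = D G has spectral radius less than 1, for a
    weighted maximum of the block norms to decrease along the coupled system.

    The weights: since the spectral radius is less than 1 and P is nonnegative,
    the equation v = 1 + P v has a solution with entries at least 1
    ([positive_supersolution]).  Row j reads M_j (G v)_j = lambda_j (v_j - 1),
    so that on a vector whose blocks have size v_k the coupling into block j is
    smaller than the decay lambda_j v_j by a fixed amount.

    The norms: the constants M_j, which may exceed 1, would spoil an estimate over
    short times.  The norm |x|_j = sup over t >= 0 of e^(lambda_j t) nu_j(e^(t A_j) x)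
    is equivalent to nu_j, with nu_j <= |.|_j <= M_j nu_j, and satisfies
    |e^(t A_j) x|_j <= e^(- lambda_j t) |x|_j ([lyapunov_norm_exp]).  The constant M_j then enters only
    through the coupling term.

    The contraction: let B = A + Delta.  For small h, block j of e^(h B) z is
    e^(h A_j) z_j + h (Delta z)_j + o(h).  With the weights v_j and the norms
    |.|_j this shows that e^(h B) shrinks the weighted maximum norm by e^(- eps h)
    for some eps > 0 and all small h ([lyapunov_step]).  By the semigroup law the
    same factor holds for all times ([weighted_box_exp]), so e^(t B) decays
    exponentially in any norm ([mx_exp_decay]).

    Finally x' = B x has exactly the solutions t |-> e^(t B) x(0)
    ([linear_solution], [linear_ode_unique]), and the exponential estimate gives
    stability and attractivity ([exp_decay_stable]).  The derivative of the matrix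
    exponential is obtained entrywise from the theory of scalar power series. *)

(** * Calculus of matrix-valued functions and the matrix exponential *)

Section MatrixAnalysis.
Context {R : realType}.

Lemma ler_mx_entry m n (A : 'M[R]_(m, n)) i j : `|A i j| <= `|A|.
Proof.
rewrite [leRHS]/Num.Def.normr/= mx_normrE.
exact: (le_bigmax _ (fun ij : 'I_m * 'I_n => `|A ij.1 ij.2|) (i, j)).
Qed.

Lemma mx_norm_le m n (A : 'M[R]_(m, n)) c :
  0 <= c -> (forall i j, `|A i j| <= c) -> `|A| <= c.
Proof.
move=> c0 Ac; rewrite [leLHS]/Num.Def.normr/= mx_normrE.
by apply: bigmax_le => // -[i j] _.
Qed.

Lemma norm_trmx p q (x : 'M[R]_(p, q)) : `|x^T| = `|x|.
Proof.
apply/le_anti/andP; split; apply: mx_norm_le => // i j.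
  by rewrite mxE ler_mx_entry.
by rewrite (le_trans _ (ler_mx_entry x^T j i))// mxE.
Qed.

Lemma norm_mulmx_le p q k (B : 'M[R]_(p, q)) (C : 'M[R]_(q, k)) : `|B *m C| <= q%:R * `|B| * `|C|.
Proof.
apply: mx_norm_le => [|i j]; first by rewrite !mulr_ge0.
rewrite mxE (le_trans (ler_norm_sum _ _ _))//.
apply: (@le_trans _ _ (\sum_(l < q) `|B| * `|C|)).
  by apply: ler_sum => l _; rewrite normrM ler_pM// ler_mx_entry.
by rewrite sumr_const card_ord -mulrA mulr_natl.
Qed.

Lemma mx_cvgP {T} {F : set_system T} {FF : Filter F} m n
    (f : T -> 'M[R]_(m, n)) (A : 'M[R]_(m, n)) :
  f x @[x --> F] --> A <-> forall i j, f x i j @[x --> F] --> A i j.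
Proof.
split=> [fA i j|fA].
  exact: (cvg_comp _ _ fA (@coord_continuous _ _ _ i j A)).
apply/cvgrPdist_le => e e0; near=> x.
apply: mx_norm_le (ltW e0) _ => i j; rewrite !mxE.
move: i j; near: x; apply: filter_forall => i; apply: filter_forall => j.
exact: ((cvgrPdist_le _ _).1 (fA i j)).
Unshelve. all: by end_near. Qed.

Lemma is_derive_mxP m n (f : R -> 'M[R]_(m, n)) (t : R)
    (df : 'M[R]_(m, n)) :
  is_derive t 1 f df <-> forall i j, is_derive t 1 (fun s => f s i j) (df i j).
Proof.
split=> [[fd <-] i j|fd].
  split; first exact: ((derivable_mxP _ _ _).1 fd).
  by rewrite (derive_mx fd) mxE.
have dbl : derivable f t 1 by apply: (derivable_mxP _ _ _).2 => i j; have [] := fd i j.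
split=> //; rewrite (derive_mx dbl); apply/matrixP => i j; rewrite mxE.
by have [_ ->] := fd i j.
Qed.

Lemma is_derive_mulmx m n p (f : R -> 'M[R]_(m, n)) (g : R -> 'M[R]_(n, p))
    (t : R) (df : 'M[R]_(m, n)) (dg : 'M[R]_(n, p)) :
  is_derive t 1 f df -> is_derive t 1 g dg ->
  is_derive t 1 (fun s => f s *m g s) (df *m g t + f t *m dg).
Proof.
move=> /is_derive_mxP fd /is_derive_mxP gd; apply/is_derive_mxP => i j.
have -> : (fun s => (f s *m g s) i j) =
    \sum_(k < n) ((fun s => f s i k) * (fun s => g s k j)).
  by apply/funext => s; rewrite mxE fct_sumE.
apply: is_derive_eq; rewrite !mxE -big_split/=.
by apply: eq_bigr => k _; rewrite /GRing.scale/= addrC [g t k j * _]mulrC.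
Qed.

Lemma cvg_mulmx {T} {F : set_system T} {FF : Filter F} m n p
    (f : T -> 'M[R]_(m, n)) (g : T -> 'M[R]_(n, p))
    (A : 'M[R]_(m, n)) (B : 'M[R]_(n, p)) :
  f x @[x --> F] --> A -> g x @[x --> F] --> B ->
  f x *m g x @[x --> F] --> A *m B.
Proof.
move=> /mx_cvgP fA /mx_cvgP gB; apply/mx_cvgP => i j.
under eq_cvg do rewrite mxE; rewrite mxE.
by apply: cvg_big => [|l _]; [exact: add_continuous|exact: cvgM].
Qed.

Lemma is_derive_continuous m n (f : R -> 'M[R]_(m, n)) (t : R) (df : 'M[R]_(m, n)) :
  is_derive t 1 f df -> {for t, continuous f}.
Proof. by move=> [fd _]; apply/differentiable_continuous/derivable1_diffP. Qed.

Lemma is_derive_comp_affine m n (f : R -> 'M[R]_(m, n)) (a c t : R)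
    (df : 'M[R]_(m, n)) :
  is_derive (a * t + c) 1 f df ->
  is_derive t 1 (fun s => f (a * s + c)) (a *: df).
Proof.
move=> /is_derive_mxP fd; apply/is_derive_mxP => i j.
have ga : is_derive t 1 (fun s : R => a * s + c) a.
  by apply: is_derive_eq; rewrite addr0 scaler1.
have fg := fd i j.
rewrite mxE mulrC.
exact: (@is_derive1_comp _ (fun s => f s i j) (fun s : R => a * s + c)).
Qed.

(** Stated with continuity alone at the endpoints because this is what a solution
    provides at time 0; the mean value theorem applies to each entry. *)
Lemma cst_of_derive0 m n (f : R -> 'M[R]_(m, n)) (a b : R) : a <= b ->
  {within `[a, b], continuous f} ->
  (forall s, a < s < b -> is_derive s 1 f (0 : 'M[R]_(m, n))) -> f b = f a.
Proof.
move=> ab fc fd; apply/matrixP => i j; apply/eqP; rewrite -subr_eq0.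
have [| |_ _ ->] := @MVT_segment _ (fun s => f s i j) (fun=> 0) a b ab.
- move=> s; rewrite in_itv/= => /fd /is_derive_mxP/(_ i j).
  by rewrite mxE.
- move=> x; apply: (@continuous_comp (subspace `[a, b]) _ _ f (fun M : 'M[R]_(m, n) => M i j)).
    exact: fc.
  exact: coord_continuous.
- by rewrite mul0r.
Qed.

End MatrixAnalysis.

Section MatrixExponential.
Context {R : realType} {m : nat}.
Implicit Types (B : 'M[R]_m) (t : R).

Lemma exprZmx a B k : (a *: B) ^+ k = a ^+ k *: B ^+ k.
Proof.
elim: k => [|k IH]; first by rewrite !expr0 scale1r.
by rewrite !exprS IH -[LHS]scalemxAl -[X in _ *: X]scalemxAr scalerA.
Qed.

Lemma mx_expr_entry_le B k i j :
  `|(B ^+ k) i j| <= (\sum_i \sum_j `|B i j|) ^+ k.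
Proof.
set b := \sum_i _; elim: k i j => [|k IH] i j.
  by rewrite !expr0 mxE; case: eqP => _; rewrite ?normr1 ?normr0.
have row_le : \sum_j `|B i j| <= b.
  by rewrite /b [leRHS](bigD1 i)//= lerDl sumr_ge0// => l _; exact: sumr_ge0.
have b0 : 0 <= b by apply: le_trans row_le; exact: sumr_ge0.
rewrite !exprS mxE (le_trans (ler_norm_sum _ _ _))//.
apply: le_trans (ler_wpM2r (exprn_ge0 k b0) row_le); rewrite mulr_suml.
by apply: ler_sum => l _; rewrite normrM ler_wpM2l.
Qed.

(** Coefficients bounded by a multiple of the exponential series have infinite
    radius of convergence.  Together with [exp_type_diffs] this supplies, for the
    entries of a matrix exponential, the convergence of the series and of its
    first two formal derivatives that termwise differentiation requires. *)
Lemma exp_type_cvg (a : R^nat) (c b x : R) :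
  (forall k, `|a k| <= c * (b ^+ k / k`!%:R)) -> cvgn (pseries a x).
Proof.
move=> ac; apply: normed_cvg.
have ale k : `|a k * x ^+ k| <= c * exp_coeff (b * `|x|) k.
  rewrite normrM normrX (le_trans (ler_wpM2r _ (ac k)))//.
  by rewrite /exp_coeff/= exprMn [X in _ <= _ * X]mulrAC [leRHS]mulrA.
apply: (series_le_cvg _ _ ale) => [k|k|] //; first exact: le_trans (ale k).
exact: (@is_cvg_seriesZ _ _ c (is_cvg_series_exp_coeff _)).
Qed.

Lemma exp_type_diffs (a : R^nat) (c b : R) :
  (forall k, `|a k| <= c * (b ^+ k / k`!%:R)) ->
  forall k, `|pseries_diffs a k| <= (c * b) * (b ^+ k / k`!%:R).
Proof.
move=> ac k; rewrite /pseries_diffs normrM normr_nat.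
apply: le_trans (ler_wpM2l _ (ac k.+1)) _ => //.
rewrite factS exprS natrM invfM -subr_ge0 le_eqVlt; apply/orP; left.
have k1 : k.+1%:R != 0 :> R by rewrite pnatr_eq0.
by apply/eqP; field; rewrite nat1r k1 pnatr_eq0 -lt0n fact_gt0.
Qed.

(** Entry by entry, [mx_exp (t *: B)] is a scalar power series in [t]; these are
    its coefficients, so the scalar theory of power series applies. *)
Definition mx_exp_coef B (i j : 'I_m) (k : nat) : R := (k`!%:R)^-1 * (B ^+ k) i j.

Lemma mx_exp_coef_le B : exists b, forall i j k,
  `|mx_exp_coef B i j k| <= 1 * (b ^+ k / k`!%:R).
Proof.
exists (\sum_i \sum_j `|B i j|) => i j k.
rewrite /mx_exp_coef normrM normfV normr_nat mul1r mulrC ler_wpM2r ?invr_ge0//.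
exact: mx_expr_entry_le.
Qed.

Lemma mx_exp_coef_cvg B i j t : cvgn (pseries (mx_exp_coef B i j) t).
Proof. by have [b /(_ i j)/exp_type_cvg] := mx_exp_coef_le B. Qed.

Lemma mx_exp_series_entry B t i j n :
  series (fun k => (k`!%:R)^-1 *: (t *: B) ^+ k) n i j =
  pseries (mx_exp_coef B i j) t n.
Proof.
rewrite /pseries /series/= summxE; apply: eq_bigr => k _.
by rewrite exprZmx !mxE /mx_exp_coef mulrCA mulrC.
Qed.

Lemma mx_expE B t i j :
  mx_exp (t *: B) i j = limn (pseries (mx_exp_coef B i j) t).
Proof.
pose E : 'M[R]_m := \matrix_(i, j) limn (pseries (mx_exp_coef B i j) t).
suff -> : mx_exp (t *: B) = E by rewrite mxE.
apply: cvg_lim => //; apply/mx_cvgP => {}i {}j; rewrite mxE.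
under eq_cvg do rewrite mx_exp_series_entry.
exact: mx_exp_coef_cvg.
Qed.

Lemma mx_exp0 B : mx_exp (0 *: B) = 1%:M.
Proof.
apply/matrixP => i j; rewrite mx_expE.
apply: cvg_lim => //; rewrite -(cvg_shiftn 1).
rewrite (_ : (fun n => _) = cst ((1%:M : 'M[R]_m) i j)); first exact: cvg_cst.
apply/funext => n; rewrite /pseries /series/= addn1 big_nat_recl// big1.
  by rewrite /mx_exp_coef !expr0 fact0 invr1 mul1r mulr1 addr0.
by move=> k _; rewrite exprS mul0r mulr0.
Qed.

Lemma is_derive_mx_exp_entry B t i j :
  is_derive t 1 (fun s => mx_exp (s *: B) i j)
    (limn (pseries (pseries_diffs (mx_exp_coef B i j)) t)).
Proof.
have [b /(_ i j) Bb] := mx_exp_coef_le B.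
have -> : (fun s => mx_exp (s *: B) i j) =
    (fun s => limn (pseries (mx_exp_coef B i j) s)).
  by apply/funext => s; rewrite mx_expE.
have Bb1 := exp_type_diffs Bb; have Bb2 := exp_type_diffs Bb1.
apply: (@pseries_snd_diffs _ _ (`|t| + 1)).
- exact: exp_type_cvg Bb.
- exact: exp_type_cvg Bb1.
- exact: exp_type_cvg Bb2.
- by rewrite [ltRHS]ger0_norm ?addr_ge0// ltrDl.
Qed.

(** Factoring one [B] out of [B ^+ k.+1] on the left or on the right gives two
    expressions of the same formal derivative.  The first one yields the
    differential equation of the exponential, and the comparison of the two
    yields [mx_exp_comm]. *)
Lemma mx_exp_diffsl B i j k : pseries_diffs (mx_exp_coef B i j) k =
  \sum_l B i l * mx_exp_coef B l j k.
Proof.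
rewrite /pseries_diffs /mx_exp_coef factS natrM invfM mulrA mulVKf; last first.
  by rewrite pnatr_eq0.
rewrite exprS mxE mulr_sumr; apply: eq_bigr => l _; exact: mulrCA.
Qed.

Lemma mx_exp_diffsr B i j k : pseries_diffs (mx_exp_coef B i j) k =
  \sum_l mx_exp_coef B i l k * B l j.
Proof.
rewrite /pseries_diffs /mx_exp_coef factS natrM invfM mulrA mulVKf; last first.
  by rewrite pnatr_eq0.
rewrite exprSr mxE mulr_sumr; apply: eq_bigr => l _; exact: mulrA.
Qed.

Lemma pseries_sum (a : 'I_m -> R) (c : 'I_m -> R^nat) t :
  (forall l, cvgn (pseries (c l) t)) ->
  limn (pseries (fun k => \sum_l a l * c l k) t) =
  \sum_l a l * limn (pseries (c l) t).
Proof.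
move=> ct; apply: cvg_lim => //.
rewrite (_ : pseries _ t = fun n => \sum_l a l * pseries (c l) t n); last first.
  apply/funext => n; rewrite /pseries /series/=.
  under eq_bigr do rewrite mulr_suml.
  rewrite exchange_big/=; apply: eq_bigr => l _.
  by rewrite mulr_sumr; apply: eq_bigr => k _; rewrite mulrA.
apply: cvg_big => [|l _]; first exact: add_continuous.
by apply: cvgM; [exact: cvg_cst|exact: ct].
Qed.

Lemma is_derive_mx_exp B t :
  is_derive t 1 (fun s => mx_exp (s *: B)) (B *m mx_exp (t *: B)).
Proof.
apply/is_derive_mxP => i j; apply: is_derive_eq (is_derive_mx_exp_entry B t i j) _.
rewrite mxE (_ : pseries_diffs _ = fun k => \sum_l B i l * mx_exp_coef B l j k); last first.
  by apply/funext => k; exact: mx_exp_diffsl.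
rewrite pseries_sum; last by move=> l; exact: mx_exp_coef_cvg.
by apply: eq_bigr => l _; rewrite mx_expE.
Qed.

Lemma mx_exp_comm B t : B *m mx_exp (t *: B) = mx_exp (t *: B) *m B.
Proof.
have := is_derive_mx_exp B t => /is_derive_mxP dE; apply/matrixP => i j.
have [_ <-] := dE i j; have [_ ->] := is_derive_mx_exp_entry B t i j.
rewrite mxE (_ : pseries_diffs _ = fun k => \sum_l B l j * mx_exp_coef B i l k); last first.
  apply/funext => k; rewrite mx_exp_diffsr.
  by apply: eq_bigr => l _; rewrite mulrC.
rewrite pseries_sum; last by move=> l; exact: mx_exp_coef_cvg.
by apply: eq_bigr => l _; rewrite mx_expE mulrC.
Qed.

(** The curve [exp((t - s) B) x(s)] is stationary in [s], because [B] commutes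
    with its exponential; its values at [s = t] and [s = 0] are the two sides. *)
Lemma linear_ode_unique p B (x : R -> 'M[R]_(m, p)) t : 0 <= t ->
  {within `[0, +oo[, continuous x} ->
  (forall s : R, 0 < s -> is_derive s 1 x (B *m x s)) ->
  x t = mx_exp (t *: B) *m x 0.
Proof.
move=> t0 xc xd.
pose y (s : R) := mx_exp ((-1 * s + t) *: B) *m x s.
have : y t = y 0.
  apply: (@cst_of_derive0 _ _ _ y 0 t t0) => [|s /andP[s0 _]].
    have affine_cont : {within `[0, t], continuous
        (fun s => mx_exp ((-1 * s + t) *: B))}.
      apply: continuous_subspaceT => s; apply: is_derive_continuous.
      exact: is_derive_comp_affine (is_derive_mx_exp B (-1 * s + t)).
    have xc0t : {within `[0, t], continuous x}.
      by apply: continuous_subspaceW xc => s /=; rewrite !in_itv/= => /andP[->].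
    by move=> s; apply: cvg_mulmx; [exact: affine_cont|exact: xc0t].
  have dx := xd s s0.
  have dE := is_derive_comp_affine (is_derive_mx_exp B (-1 * s + t)).
  apply: is_derive_eq (is_derive_mulmx dE dx) _.
  by rewrite scaleN1r mulNmx mulmxA mx_exp_comm addNr.
by rewrite /y mulN1r addNr mx_exp0 mul1mx mulr0 add0r.
Qed.

(** Both sides solve the same linear equation in [s], with the same value at
    [s = 0]. *)
Lemma mx_expD B s t : 0 <= s -> mx_exp ((s + t) *: B) = mx_exp (s *: B) *m mx_exp (t *: B).
Proof.
move=> s0; have := @linear_ode_unique m B (fun s => mx_exp ((1 * s + t) *: B)) s s0.
rewrite mul1r mulr0 add0r; apply => [|r _].
  apply: continuous_subspaceT => r; apply: is_derive_continuous.
  exact: is_derive_comp_affine (is_derive_mx_exp B (1 * r + t)).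
by apply: is_derive_eq (is_derive_comp_affine (is_derive_mx_exp B (1 * r + t))) _; rewrite scale1r.
Qed.

End MatrixExponential.

(** * Nonnegative matrices of spectral radius less than 1 *)

Section SpectralRadius.
Context {R : realType}.

Lemma spectrum_normc_ubound n (P : 'M[R]_n) :
  has_ubound [set ComplexField.Normc.normc z | z in spectrum P].
Proof.
have [r rE] := closed_field_poly_normal (char_poly (cmx P)).
exists (\sum_(z <- r) ComplexField.Normc.normc z) => _ [z + <-].
rewrite /spectrum/= eigenvalue_root_char rE.
rewrite (monicP (char_poly_monic _)) scale1r root_prod_XsubC => zr.
have normc_ge0 (w : R[i]) : 0 <= ComplexField.Normc.normc w.
  by case: w => a b; exact: sqrtr_ge0.
by rewrite (big_rem z)//= lerDl sumr_ge0.
Qed.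

(** A supremum is an upper bound only for a bounded set: boundedness comes from
    [spectrum_normc_ubound], the eigenvalues being the finitely many roots of the
    characteristic polynomial. *)
Lemma eigenvalue_le_spectral_radius n (P : 'M[R]_n) (a : R) :
  0 <= a -> eigenvalue P a -> a <= spectral_radius P.
Proof.
move=> a0 Pa; apply: ub_le_sup; first exact: spectrum_normc_ubound.
exists (real_complex R a).
  by rewrite /spectrum/= /cmx (eigenvalue_map (real_complex R)).
by rewrite /= expr0n addr0 sqrtr_sqr ger0_norm.
Qed.

Lemma det_continuous n (f : R -> 'M[R]_n) s :
  {for s, continuous f} -> {for s, continuous (fun t => \det (f t))}.
Proof.
move=> /mx_cvgP fs; apply: cvg_big => [|p _]; first exact: add_continuous.
apply: cvgM; first exact: cvg_cst.
by apply: cvg_big => [|i _]; [exact: mul_continuous|exact: fs].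
Qed.

Lemma adj_continuous n (f : R -> 'M[R]_n) s :
  {for s, continuous f} -> {for s, continuous (fun t => \adj (f t))}.
Proof.
move=> /mx_cvgP fs; apply/mx_cvgP => i j; rewrite mxE.
under eq_cvg do rewrite mxE.
apply: cvgM; first exact: cvg_cst.
apply: det_continuous; apply/mx_cvgP => k l; rewrite !mxE.
by under eq_cvg do rewrite !mxE; exact: fs.
Qed.

(** A kernel vector of [1 - s P] would be an eigenvector of [P] for the
    eigenvalue [1 / s >= 1]. *)
Lemma det_1_sub_scale_neq0 n (P : 'M[R]_n) (s : R) :
  spectral_radius P < 1 -> 0 <= s <= 1 -> \det (1%:M - s *: P) != 0.
Proof.
move=> P1 /andP[s0 s1]; apply/det0P => -[v v0].
rewrite mulmxBr mulmx1 -scalemxAr => /eqP; rewrite subr_eq0 => /eqP vE.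
have {}s0 : 0 < s.
  rewrite lt_def s0 andbT; apply: contra v0 => /eqP s0'.
  by rewrite vE s0' scale0r.
suff : s^-1 <= spectral_radius P.
  by apply/negP; rewrite -ltNge (lt_le_trans P1)// invf_ge1.
apply: eigenvalue_le_spectral_radius; first by rewrite invr_ge0 ltW.
apply/eigenvalueP; exists v => //.
by rewrite [in RHS]vE scalerA mulVf ?scale1r// gt_eqF.
Qed.

(** This replaces the Perron-Frobenius theorem.  For [s] in [0, 1] the equation
    [v = 1 + s P v] has a unique solution, which depends continuously on [s].  As
    [P] is nonnegative, as soon as this solution is nonnegative its entries are
    at least 1.  Hence its least entry, which equals 1 at [s = 0], cannot take
    the value 1/2, and by the intermediate value theorem it never becomes
    negative. *)
Lemma positive_supersolution n (P : 'M[R]_n) :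
  (forall i j, 0 <= P i j) -> spectral_radius P < 1 ->
  exists2 v : 'cV[R]_n, v = const_mx 1 + P *m v & forall i, 1 <= v i 0.
Proof.
move=> P0 P1; pose one : 'cV[R]_n := const_mx 1.
pose A s := 1%:M - s *: P.
pose v s : 'cV[R]_n := (\det (A s))^-1 *: (\adj (A s) *m one).
have vE s : 0 <= s <= 1 -> v s = one + s *: (P *m v s).
  move=> s01; have : A s *m v s = one.
    rewrite -scalemxAr mulmxA mul_mx_adj mul_scalar_mx scalerA mulVf ?scale1r//.
    exact: det_1_sub_scale_neq0.
  by rewrite {1}/A mulmxBl mul1mx -scalemxAl => <-; rewrite subrK.
have v_ge1 s : 0 <= s <= 1 -> (forall i, 0 <= v s i 0) -> forall i, 1 <= v s i 0.
  move=> s01 vs0 i; rewrite vE// !mxE lerDl mulr_ge0//; first by case/andP: s01.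
  by apply: sumr_ge0 => j _; exact: mulr_ge0.
(* Starting the minimum at 1 is harmless and covers the case of no entry. *)
pose f s := \big[Num.min/1]_i v s i 0.
have f_cont : {within `[0, 1], continuous f}.
  apply: continuous_in_subspaceT => s; rewrite inE/= in_itv/= => s01.
  apply: cvg_big => [|i _]; first exact: min_continuous.
  have A_cont : {for s, continuous A}.
    apply: cvgB; first exact: cvg_cst.
    by apply: cvgZr_tmp; exact: cvg_id.
  rewrite mxE; under eq_cvg do rewrite mxE.
  apply: cvgM.
    by apply: cvgV; [exact: det_1_sub_scale_neq0|exact: det_continuous].
  have adj_cont := adj_continuous A_cont.
  exact: (mx_cvgP _ _).1 (cvg_mulmx adj_cont (cvg_cst one)) i 0.
have f_le (s : R) i : f s <= v s i 0 by exact: bigmin_le.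
have f0 : f 0 = 1.
  have vs0 : v 0 = one by rewrite vE ?lexx ?ler01// scale0r addr0.
  rewrite /f vs0; apply: big1_idem => [|i _]; [exact: minxx|by rewrite mxE].
have f1 : 2^-1 <= f 1.
  rewrite leNgt; apply/negP => f1.
  have [|c c01 fc] := IVT ler01 f_cont (v := 2^-1).
    by rewrite f0 ge_min le_max (ltW f1) orbT invf_le1//= ler1n.
  have : 1 <= f c.
    apply: le_bigmin => // i _; apply: v_ge1; first by move: c01; rewrite in_itv.
    by move=> {}i; apply: le_trans (f_le c i); rewrite fc.
  by rewrite fc leNgt invf_lt1// ltr1n.
exists (v 1); first by rewrite {1}vE ?lexx ?ler01// scale1r.
apply: v_ge1; rewrite ?lexx ?ler01// => i.
by apply: le_trans (f_le 1 i); apply: le_trans f1; rewrite invr_ge0.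
Qed.

End SpectralRadius.

(** * Vector norms, operator norms and the adapted norm of a decaying semigroup *)

Section VectorNorm.
Context {R : realType} {m : nat} {nu : 'cV[R]_m -> R}.
Hypothesis nu_norm : vector_norm nu.

Let nuD := vector_norm_triangle nu_norm.
Let nuZ := vector_norm_homogeneous nu_norm.

Lemma vector_norm0 : nu 0 = 0.
Proof. by rewrite -(scale0r 0) nuZ normr0 mul0r. Qed.

Lemma vector_normN x : nu (- x) = nu x.
Proof. by rewrite -scaleN1r nuZ normrN1 mul1r. Qed.

Lemma vector_norm_ge0 x : 0 <= nu x.
Proof.
have := nuD x (- x); rewrite subrr vector_norm0 vector_normN -mulr2n.
by rewrite pmulrn_lge0.
Qed.

Lemma vector_norm_gt0 x : x != 0 -> 0 < nu x.
Proof.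
move=> x0; rewrite lt_def vector_norm_ge0 andbT.
by apply: contra x0 => /eqP/(vector_norm_definite nu_norm)/eqP.
Qed.

Lemma vector_norm_sum I (r : seq I) (f : I -> 'cV[R]_m) :
  nu (\sum_(i <- r) f i) <= \sum_(i <- r) nu (f i).
Proof.
elim: r => [|i r IH]; first by rewrite !big_nil vector_norm0.
by rewrite !big_cons (le_trans (nuD _ _))// lerD2l.
Qed.

Lemma vector_norm_le_sup : exists2 C, 0 <= C & forall x, nu x <= C * `|x|.
Proof.
exists (\sum_i nu (delta_mx i 0)) => [|x].
  by apply: sumr_ge0 => i _; exact: vector_norm_ge0.
rewrite {1}(matrix_sum_delta x).
under eq_bigr do rewrite big_ord1.
rewrite (le_trans (vector_norm_sum _ _))// mulr_suml.
apply: ler_sum => i _; rewrite nuZ mulrC.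
by rewrite ler_wpM2l ?vector_norm_ge0// ler_mx_entry.
Qed.

(** The reverse triangle inequality and [vector_norm_le_sup] make the norm
    Lipschitz. *)
Lemma vector_norm_continuous : continuous nu.
Proof.
have [C C0 nuC] := vector_norm_le_sup.
have dist x y : nu x - nu y <= nu (x - y).
  by rewrite lerBlDr -{1}(subrK y x) nuD.
move=> x; apply: (cvgrPdist_le (FF := nbhs_filter x) _ _).2 => e e0.
have C1 : 0 < C + 1 by rewrite ltr_wpDl.
near=> y.
have xy : nu (x - y) <= e.
  apply: le_trans (nuC _) _; apply: (@le_trans _ _ ((C + 1) * `|x - y|)).
    by rewrite ler_wpM2r// lerDl.
  rewrite -ler_pdivlMl// mulrC; near: y.
  by apply: cvgr_dist_le => //; rewrite divr_gt0.
rewrite ler_norml lerNl opprB (le_trans (dist x y) xy) andbT.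
by rewrite (le_trans (dist y x))// -vector_normN opprB.
Unshelve. all: by end_near. Qed.

(** The norm attains a minimum on the unit sphere of the max norm, which is
    compact, and this minimum is positive by definiteness. *)
Lemma sup_le_vector_norm : exists2 C, 0 <= C & forall x, `|x| <= C * nu x.
Proof.
pose S := [set u : 'rV[R]_m | `|u| = 1].
have [S0|S_empty] := pselect (S !=set0); last first.
  (* The sphere is empty only in dimension 0. *)
  exists 0 => // x; rewrite mul0r normr_le0.
  apply/negPn/negP => x0; apply: S_empty; exists (`|x|^-1 *: x^T).
  by rewrite /S/= normrZ norm_trmx normfV normr_id mulVf// normr_eq0.
have S_compact : compact S.
  apply: bounded_closed_compact.
    by exists 1; split=> // r r1 u /= ->; exact: ltW.
  apply: (@closed_comp _ _ (fun u : 'rV[R]_m => `|u|) [set 1]).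
    by move=> u _; exact: norm_continuous.
  exact: closed_eq.
have f_cont : continuous (fun u : 'rV[R]_m => nu u^T).
  move=> u; apply: continuous_comp; last exact: vector_norm_continuous.
  apply: (mx_cvgP (FF := nbhs_filter u) _ _).2 => i j; rewrite mxE.
  under eq_cvg do rewrite mxE.
  exact: coord_continuous.
have [u + umin] := EVT_min_rV S0 S_compact (continuous_subspaceT f_cont).
rewrite inE => u1.
have nu_u : 0 < nu u^T.
  apply: vector_norm_gt0; apply: contra_eq_neq u1 => u0.
  by rewrite -norm_trmx u0 normr0 eq_sym oner_eq0.
exists (nu u^T)^-1 => [|x]; first by rewrite invr_ge0 ltW.
have [->|x0] := eqVneq x 0; first by rewrite normr0 vector_norm0 mulr0.
have := umin (`|x|^-1 *: x^T).
rewrite inE /S/= normrZ norm_trmx normfV normr_id mulVf ?normr_eq0// => /(_ erefl).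
rewrite linearZ/= trmxK nuZ normfV normr_id.
by rewrite ler_pdivlMl ?normr_gt0// ler_pdivlMl// mulrC.
Qed.

End VectorNorm.

Section OperatorNorm.
Context {R : realType} {p q : nat}.
Context {nuin : 'cV[R]_q -> R} {nuout : 'cV[R]_p -> R}.
Hypothesis nuin_norm : vector_norm nuin.
Hypothesis nuout_norm : vector_norm nuout.
Implicit Types B : 'M[R]_(p, q).

(** Without this bound the supremum would be the default value 0 and would
    carry no information. *)
Lemma operator_norm_ubound B :
  has_ubound [set nuout (B *m x) | x in [set x | nuin x <= 1]].
Proof.
have [C C0 nuC] := vector_norm_le_sup nuout_norm.
have [c c0 nuc] := sup_le_vector_norm nuin_norm.
exists (C * (q%:R * `|B| * c)) => _ [x /= x1 <-].
rewrite (le_trans (nuC _))// ler_wpM2l// (le_trans (norm_mulmx_le _ _))//.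
rewrite ler_wpM2l ?mulr_ge0// (le_trans (nuc _))//.
by rewrite -[leRHS]mulr1 ler_wpM2l.
Qed.

Lemma operator_norm_ge0 B : 0 <= operator_norm nuin nuout B.
Proof.
apply: ub_le_sup; first exact: operator_norm_ubound.
by exists 0; rewrite /= ?vector_norm0// mulmx0 vector_norm0.
Qed.

Lemma operator_norm_le B x :
  nuout (B *m x) <= operator_norm nuin nuout B * nuin x.
Proof.
have [->|x0] := eqVneq x 0; first by rewrite mulmx0 !vector_norm0// mulr0.
have nux := vector_norm_gt0 nuin_norm x0.
rewrite -ler_pdivrMr//; apply: ub_le_sup; first exact: operator_norm_ubound.
exists ((nuin x)^-1 *: x); rewrite /= -?scalemxAr vector_norm_homogeneous//.
  by rewrite gtr0_norm ?invr_gt0// mulVf// gt_eqF.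
by rewrite gtr0_norm ?invr_gt0// mulrC.
Qed.

End OperatorNorm.

Section LyapunovNorm.
Context {R : realType} {m : nat} {nu : 'cV[R]_m -> R} {A : 'M[R]_m} {M lambda : R}.
Hypothesis nu_norm : vector_norm nu.
Hypothesis exp_bound : forall t : R, 0 <= t ->
  operator_norm nu nu (mx_exp (t *: A)) <= M * expR (- lambda * t).

Let orbit (x : 'cV[R]_m) : set R :=
  [set expR (lambda * t) * nu (mx_exp (t *: A) *m x) | t in [set t | 0 <= t]].

(** The equivalent norm for which the semigroup [exp(t A)] satisfies the decay
    estimate with constant 1 instead of [M].  Over short times the estimate can
    then be compared with the first-order effect of a perturbation. *)
Definition lyapunov_norm (x : 'cV[R]_m) : R := sup (orbit x).

Let orbit_ubound x : ubound (orbit x) (M * nu x).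
Proof.
move=> _ [t /= t0 <-].
rewrite -ler_pdivlMl ?expR_gt0// -expRN -mulNr mulrCA mulrA.
apply: le_trans (operator_norm_le nu_norm nu_norm _ _) _.
by rewrite ler_wpM2r ?vector_norm_ge0// exp_bound.
Qed.

Let orbit_neq0 x : orbit x !=set0.
Proof. by eexists; exists 0 => /=. Qed.

Let orbit_le_lyapunov t x : 0 <= t ->
  expR (lambda * t) * nu (mx_exp (t *: A) *m x) <= lyapunov_norm x.
Proof. by move=> t0; apply: ub_le_sup; [exists (M * nu x)|exists t]. Qed.

Lemma le_lyapunov_norm x : nu x <= lyapunov_norm x.
Proof.
by have := orbit_le_lyapunov x (lexx 0); rewrite mulr0 expR0 mx_exp0 mul1r mul1mx.
Qed.

Lemma lyapunov_norm_le x : lyapunov_norm x <= M * nu x.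
Proof. exact: ge_sup. Qed.

Lemma lyapunov_normD x y :
  lyapunov_norm (x + y) <= lyapunov_norm x + lyapunov_norm y.
Proof.
apply: ge_sup => // _ [t /= t0 <-]; rewrite mulmxDr.
apply: le_trans (lerD (orbit_le_lyapunov x t0) (orbit_le_lyapunov y t0)).
by rewrite -mulrDr ler_wpM2l ?expR_ge0// vector_norm_triangle.
Qed.

Lemma lyapunov_norm_exp h x : 0 <= h ->
  lyapunov_norm (mx_exp (h *: A) *m x) <= expR (- lambda * h) * lyapunov_norm x.
Proof.
move=> h0; apply: ge_sup => // _ [t /= t0 <-].
rewrite -ler_pdivrMl ?expR_gt0// -expRN mulNr opprK mulrA -expRD -mulrDr.
by rewrite mulmxA -mx_expD// addrC orbit_le_lyapunov// addr_ge0.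
Qed.

End LyapunovNorm.

Arguments lyapunov_norm {R m} nu A lambda x.

(** * Contraction of the coupled system *)

Section FirstOrder.
Context {R : realType}.

Lemma derive0_littleo m n (f : R -> 'M[R]_(m, n)) :
  f 0 = 0 -> is_derive (0 : R) 1 f (0 : 'M[R]_(m, n)) ->
  forall e : R, 0 < e -> \forall h \near (0:R)^'+, `|f h| <= e * h.
Proof.
move=> f0 [fd fd0] e e0.
have quot0 : h^-1 *: (f (h *: 1 + 0) - f 0) @[h --> (0 : R)^'] --> (0 : 'M[R]_(m, n)).
  by rewrite -[X in _ --> X]fd0; exact: fd.
have /cvgr0_norm_le/(_ e e0) quot_le := cvg_dnbhs_at_right quot0.
near=> h; have h0 : 0 < h by near: h; exact: nbhs_right_gt.
have : `|h^-1 *: (f (h *: 1 + 0) - f 0)| <= e by near: h.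
rewrite addr0 f0 subr0 [h *: 1]mulr1 normrZ gtr0_norm ?invr_gt0//.
by rewrite ler_pdivrMl// mulrC.
Unshelve. all: by end_near. Qed.

(** From [1 + x <= expR x] and [1 <= (1 + x) (1 - x + x ^+ 2)]. *)
Lemma expRN_le (x : R) : 0 <= x -> expR (- x) <= 1 - x + x ^+ 2.
Proof.
move=> x0; have x1 : 0 < 1 + x by rewrite ltr_wpDr.
rewrite expRN; apply: (@le_trans _ _ (1 + x)^-1).
  by rewrite lef_pV2 ?posrE ?expR_gt0// expR_ge1Dx.
rewrite -[leLHS]mulr1 ler_pdivrMl// -subr_ge0.
have -> : (1 + x) * (1 - x + x ^+ 2) - 1 = x ^+ 3 by ring.
exact: exprn_ge0.
Qed.

(** A first-order perturbation formula: if [P B = A P + E], then the curves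
    [P exp(h B)] and [exp(h A) P + h E] agree at 0 together with their
    derivatives.  It is used with [P] the projection on one block. *)
Lemma mx_exp_intertwine p q (P : 'M[R]_(p, q)) (B : 'M[R]_q) (A : 'M[R]_p)
    (E : 'M[R]_(p, q)) :
  P *m B = A *m P + E -> forall e : R, 0 < e -> \forall h \near (0:R)^'+,
  `|P *m mx_exp (h *: B) - (mx_exp (h *: A) *m P + h *: E)| <= e * h.
Proof.
move=> PB; apply: derive0_littleo.
  by rewrite !mx_exp0 mulmx1 mul1mx scale0r addr0 subrr.
have dB := is_derive_mulmx (is_derive_cst P (0 : R) (1 : R)) (is_derive_mx_exp B 0).
have dA := is_derive_mulmx (is_derive_mx_exp A 0) (is_derive_cst P (0 : R) (1 : R)).
have dE : is_derive (0 : R) 1 (fun h : R => h *: E) E.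
  apply/is_derive_mxP => i j; under eq_fun do rewrite mxE mulrC.
  have := is_deriveZ (E i j) (is_derive_id (0 : R) (1 : R)).
  by rewrite /GRing.scale/= mulr1.
apply: is_derive_eq (is_deriveB dB (is_deriveD dA dE)) _.
by rewrite !mx_exp0 mul0mx mulmx0 add0r addr0 !mulmx1 PB subrr.
Qed.

End FirstOrder.

Section CoupledSystem.
Context {R : realType} {n : nat} {N : 'I_n -> nat}.
Context {nu : forall j : 'I_n, 'cV[R]_(N j) -> R}.
Arguments nu : clear implicits.
Context {A : forall j : 'I_n, 'M[R]_(N j)}.
Context {Delta : forall j k : 'I_n, 'M[R]_(N j, N k)}.
Context {M lambda : 'I_n -> R} {v : 'I_n -> R}.
Hypothesis nu_norm : forall j, vector_norm (nu j).
Hypothesis M_gt0 : forall j, 0 < M j.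
Hypothesis lambda_gt0 : forall j, 0 < lambda j.
Hypothesis exp_bound : forall (j : 'I_n) (t : R), 0 <= t ->
  operator_norm (nu j) (nu j) (mx_exp (t *: A j)) <= M j * expR (- lambda j * t).
Hypothesis v_ge1 : forall j, 1 <= v j.
Hypothesis coupling_small : forall j,
  M j * \sum_k operator_norm (nu k) (nu j) (Delta j k) * v k <= lambda j * (v j - 1).

Let B : 'M[R]_(\sum_j N j) := \mxdiag_j A j + \mxblock_(j, k) Delta j k.
Let L j : 'cV[R]_(N j) -> R := lyapunov_norm (nu j) (A j) (lambda j).
Arguments L : clear implicits.

(** The closed ball of radius [K] for the norm that takes the maximum over [k] of
    the Lyapunov norm of the block [k] divided by the weight [v k]. *)
Definition weighted_box (K : R) (z : 'cV[R]_(\sum_j N j)) :=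
  forall k, L k (submxcol z k) <= K * v k.

Lemma norm_submxcol_le (z : 'cV[R]_(\sum_j N j)) k : `|submxcol z k| <= `|z|.
Proof. by apply: mx_norm_le => // i j; rewrite mxE ler_mx_entry. Qed.

Lemma norm_le_sum_submxcol (z : 'cV[R]_(\sum_j N j)) :
  `|z| <= \sum_k `|submxcol z k|.
Proof.
apply: mx_norm_le => [|s j]; first exact: sumr_ge0.
rewrite -{1}(submxcolK z) mxE (bigD1 (tagnat.sig1 s))//= -[leLHS]addr0.
by rewrite lerD// ?ler_mx_entry// sumr_ge0.
Qed.

Lemma weighted_box_norm : exists2 C, 0 <= C &
  forall (K : R) z, 0 <= K -> weighted_box K z -> `|z| <= C * K.
Proof.
pose c k := s2val (cid2 (sup_le_vector_norm (nu_norm k))).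
have c0 k : 0 <= c k by rewrite /c; case: cid2.
have cle k x : `|x| <= c k * nu k x by rewrite /c; case: cid2.
exists (\sum_k c k * v k) => [|K z K0 zK].
  by apply: sumr_ge0 => k _; rewrite mulr_ge0// (le_trans ler01).
rewrite (le_trans (norm_le_sum_submxcol z))// mulr_suml.
apply: ler_sum => k _; rewrite (le_trans (cle _ _))// -mulrA ler_wpM2l//.
by rewrite mulrC (le_trans _ (zK k))// (le_lyapunov_norm (nu_norm k) (@exp_bound k)).
Qed.

Lemma norm_weighted_box : exists2 C, 0 <= C & forall z, weighted_box (C * `|z|) z.
Proof.
pose c k := s2val (cid2 (vector_norm_le_sup (nu_norm k))).
have c0 k : 0 <= c k by rewrite /c; case: cid2.
have lec k x : nu k x <= c k * `|x| by rewrite /c; case: cid2.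
have Mc0 k : 0 <= M k * c k by rewrite mulr_ge0// ltW.
exists (\sum_k M k * c k) => [|z k]; first exact: sumr_ge0.
apply: le_trans (lyapunov_norm_le (nu_norm k) (@exp_bound k) _) _.
apply: (@le_trans _ _ (M k * c k * `|z|)).
  rewrite -mulrA ler_pM2l// (le_trans (lec _ _))// ler_wpM2l//.
  exact: norm_submxcol_le.
rewrite -[leLHS]mulr1 ler_pM//; first by rewrite mulr_ge0.
by rewrite ler_wpM2r// (bigD1 k)//= lerDl sumr_ge0.
Qed.

Lemma submxcol_generator k :
  submxcol 1%:M k *m B =
  A k *m submxcol 1%:M k + submxcol (\mxblock_(j, l) Delta j l) k.
Proof.
rewrite submxcol_mul mul1mx submxcolD; congr (_ + _).
rewrite -[X in submxcol X k = _]mulmx1.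
by rewrite -{1}(submxcolK 1%:M) mul_mxdiag_mxcol mxcolK.
Qed.

(** On a box of weights [v] the coupling term uses up at most the share
    [v k - 1] of the decay [lambda k * v k] of the block [k].  The share that is
    left makes the box contract. *)
Lemma coupling_norm_le K z k : 0 <= K -> weighted_box K z ->
  M k * nu k (submxcol (\mxblock_(j, l) Delta j l) k *m z) <= K * (lambda k * (v k - 1)).
Proof.
move=> K0 zK.
have -> : submxcol (\mxblock_(j, l) Delta j l) k *m z =
    \sum_l Delta k l *m submxcol z l.
  rewrite submxcol_mul -{1}(submxcolK z) mxblockEh mul_mxrow_mxcol.
  rewrite -[RHS](mxcolK (fun i => \sum_l Delta i l *m submxcol z l)).
  by rewrite mxcol_sum; congr (submxcol _ k); apply: eq_bigr => l _; exact: mxcol_mul.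
apply: le_trans (ler_wpM2l K0 (coupling_small k)).
rewrite mulrCA ler_pM2l// mulr_sumr (le_trans (vector_norm_sum (nu_norm k) _ _))//.
apply: ler_sum => l _; rewrite (le_trans (operator_norm_le (nu_norm l) (nu_norm k) _ _))//.
rewrite mulrCA ler_wpM2l ?operator_norm_ge0//.
by rewrite (le_trans _ (zK l))// (le_lyapunov_norm (nu_norm l) (@exp_bound l)).
Qed.

(** Up to [o(h)], the block [k] of [exp(h B) z] is [exp(h A_k) z_k] plus [h] times
    the coupling term.  In units of [K], the first summand is at most
    [v k - h lambda_k v k] to first order and the second one at most
    [h lambda_k (v k - 1)].  The sum is [v k - h lambda_k]; a quarter of the gain
    [h lambda_k] pays for the second-order term of the scalar exponential, half of
    it for the remainder, and the last quarter is the decay that is claimed. *)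
Lemma lyapunov_step (eps : R) k : eps * v k <= lambda k / 4 ->
  \forall h \near (0 : R)^'+, forall (K : R) z, 0 <= K -> weighted_box K z ->
    L k (submxcol (mx_exp (h *: B) *m z) k) <= K * expR (- eps * h) * v k.
Proof.
move=> eps_le; have lam0 := lambda_gt0 k.
have v0 : 0 < v k by rewrite (lt_le_trans ltr01).
have [C C0 nuC] := vector_norm_le_sup (nu_norm k).
have [c c0 cbox] := weighted_box_norm.
pose Q := M k * (C * ((\sum_j N j)%:R * c)).
have Q0 : 0 <= Q by rewrite !mulr_ge0// ltW.
(* The remainder contributes at most [K * (h * (e * Q))]; this [e] brings it
   below half of the gain. *)
pose e := lambda k / (2 * (Q + 1)).
have Q1 : 0 < Q + 1 by rewrite ltr_wpDl.
have e0 : 0 < e by rewrite divr_gt0// mulr_gt0.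
have eQ : e * Q <= lambda k / 2.
  rewrite /e mulrAC ler_pdivrMr ?mulr_gt0//.
  have -> : lambda k / 2 * (2 * (Q + 1)) = lambda k * (Q + 1) by field.
  by rewrite ler_pM2l// lerDl.
have rem_small := mx_exp_intertwine (submxcol_generator k) e0.
near=> h => K z K0 zK.
have h0 : 0 < h by near: h; exact: nbhs_right_gt.
have rem_le : `|submxcol 1%:M k *m mx_exp (h *: B) -
    (mx_exp (h *: A k) *m submxcol 1%:M k +
     h *: submxcol (\mxblock_(j, l) Delta j l) k)| <= e * h.
  by near: h; exact: rem_small.
set E := submxcol (\mxblock_(j, l) Delta j l) k in rem_le *.
set rem := _ - _ in rem_le.
have h_small : h <= (4 * lambda k * v k)^-1.
  by near: h; apply: nbhs_right_le; rewrite invr_gt0 !mulr_gt0.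
have -> : submxcol (mx_exp (h *: B) *m z) k =
    mx_exp (h *: A k) *m submxcol z k + (h *: (E *m z) + rem *m z).
  have -> : mx_exp (h *: A k) *m submxcol z k =
      mx_exp (h *: A k) *m submxcol 1%:M k *m z.
    by rewrite -mulmxA submxcol_mul mul1mx.
  rewrite scalemxAl addrA -mulmxDl -mulmxDl addrC subrK.
  by rewrite -mulmxA submxcol_mul mul1mx.
pose LD := lyapunov_normD (nu_norm k) (@exp_bound k).
pose LM := lyapunov_norm_le (nu_norm k) (@exp_bound k).
apply: le_trans (LD _ _) _.
have diag_le : L k (mx_exp (h *: A k) *m submxcol z k) <=
    K * (v k - h * (lambda k * v k) + h * (lambda k / 4)).
  apply: le_trans (lyapunov_norm_exp (nu_norm k) (@exp_bound k) _ (ltW h0)) _.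
  apply: le_trans (ler_wpM2l (expR_ge0 _) (zK k)) _.
  rewrite mulrCA ler_wpM2l// mulNr.
  have lh0 : 0 <= lambda k * h by rewrite mulr_ge0// ltW.
  apply: le_trans (ler_wpM2r (ltW v0) (expRN_le lh0)) _.
  have : h * (4 * lambda k * v k) <= 1.
    by rewrite -ler_pdivlMr ?mul1r// !mulr_gt0.
  move=> /(ler_wpM2l (mulr_ge0 (ltW h0) (ltW lam0))) hh.
  rewrite -subr_ge0; rewrite -subr_ge0 in hh.
  suff -> : v k - h * (lambda k * v k) + h * (lambda k / 4) -
    (1 - lambda k * h + (lambda k * h) ^+ 2) * v k =
    (h * lambda k * 1 - h * lambda k * (h * (4 * lambda k * v k))) / 4.
    by rewrite divr_ge0.
  by field.
have coupling_le : M k * nu k (h *: (E *m z)) <= K * (h * (lambda k * (v k - 1))).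
  rewrite (vector_norm_homogeneous (nu_norm k)) gtr0_norm// mulrCA [leRHS]mulrCA.
  by rewrite ler_pM2l// coupling_norm_le.
have rem_z_le : M k * nu k (rem *m z) <= K * (h * (lambda k / 2)).
  apply: (@le_trans _ _ (K * (h * (e * Q)))); last first.
    by rewrite !ler_wpM2l// ltW.
  have -> : K * (h * (e * Q)) =
      M k * (C * ((\sum_j N j)%:R * (e * h) * (c * K))) by rewrite /Q; ring.
  rewrite ler_pM2l// (le_trans (nuC _))// ler_wpM2l//.
  rewrite (le_trans (norm_mulmx_le _ _))// ler_pM ?mulr_ge0//.
    by rewrite ler_wpM2l.
  exact: cbox.
have rest_le : L k (h *: (E *m z) + rem *m z) <=
    K * (h * (lambda k * (v k - 1))) + K * (h * (lambda k / 2)).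
  apply: le_trans (LM _) (le_trans _ (lerD coupling_le rem_z_le)).
  by rewrite -mulrDr ler_pM2l// (vector_norm_triangle (nu_norm k)).
apply: le_trans (lerD diag_le rest_le) _.
rewrite -!mulrDr -mulrA ler_wpM2l//.
apply: (@le_trans _ _ ((1 - eps * h) * v k)); last first.
  rewrite ler_wpM2r ?(ltW v0)// mulNr; exact: expR_ge1Dx.
have := ler_wpM2l (ltW h0) eps_le; lra.
Unshelve. all: by end_near. Qed.

(** The minimum starts at 1 so that it is positive also when there is no block. *)
Lemma exists_rate : exists2 eps : R, 0 < eps & forall k, eps * v k <= lambda k / 4.
Proof.
have v0 k : 0 < v k by rewrite (lt_le_trans ltr01).
exists (\big[Num.min/1]_k (lambda k / 4 / v k)) => [|k].
  by apply: lt_bigmin => // k _; rewrite !divr_gt0.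
by rewrite -ler_pdivlMr// bigmin_le.
Qed.

(** A time [t] is cut into equal steps that are short enough for
    [lyapunov_step], and the semigroup law multiplies the factors. *)
Lemma weighted_box_exp (eps : R) : (forall k, eps * v k <= lambda k / 4) ->
  forall (t K : R) z, 0 <= t -> 0 <= K -> weighted_box K z ->
  weighted_box (K * expR (- eps * t)) (mx_exp (t *: B) *m z).
Proof.
move=> eps_le t K z t0 K0 zK.
have step : \forall h \near (0 : R)^'+, forall (K : R) z, 0 <= K -> weighted_box K z ->
    weighted_box (K * expR (- eps * h)) (mx_exp (h *: B) *m z).
  have : \forall h \near (0 : R)^'+, forall k, forall (K : R) z, 0 <= K -> weighted_box K z ->
      L k (submxcol (mx_exp (h *: B) *m z) k) <= K * expR (- eps * h) * v k.
    by apply: filter_forall => k; exact: lyapunov_step.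
  by apply: filterS => h hk K' z' K'0 zK' k; exact: hk.
move: t0; rewrite le_eqVlt => /predU1P[<-|t0].
  by rewrite mulr0 expR0 mulr1 mx_exp0 mul1mx.
have [p hp] : exists p, forall (K : R) z, 0 <= K -> weighted_box K z ->
    weighted_box (K * expR (- eps * (t / p.+1%:R))) (mx_exp ((t / p.+1%:R) *: B) *m z).
  move: step => [d /= d0 step].
  have [p tp] : exists p : nat, t / p.+1%:R < d.
    exists (Num.bound (t / d)).
    rewrite ltr_pdivrMr// mulrC -ltr_pdivrMr//.
    have td0 : 0 <= t / d by rewrite divr_ge0// ltW.
    by rewrite (lt_trans (archi_boundP td0))// ltr_nat.
  have tp0 : 0 < t / p.+1%:R by rewrite divr_gt0.
  by exists p; apply: step => //=; rewrite sub0r normrN gtr0_norm.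
move: hp; set s := t / p.+1%:R => hp.
have s0 : 0 <= s by rewrite divr_ge0// ltW.
have iter q : weighted_box (K * expR (- eps * (q%:R * s)))
    (mx_exp ((q%:R * s) *: B) *m z).
  elim: q => [|q IH]; first by rewrite mul0r mulr0 expR0 mulr1 mx_exp0 mul1mx.
  rewrite -nat1r mulrDl mul1r mx_expD// -mulmxA.
  rewrite mulrDr expRD [expR _ * _]mulrC mulrA.
  by apply: (hp _ _ _ IH); rewrite mulr_ge0// expR_ge0.
have <- : p.+1%:R * s = t by rewrite /s mulrC divfK ?pnatr_eq0.
exact: iter.
Qed.

Lemma mx_exp_decay : exists2 eps : R, 0 < eps & exists2 C, 0 <= C &
  forall (t : R) (z : 'cV_(\sum_j N j)), 0 <= t ->
    `|mx_exp (t *: B) *m z| <= C * `|z| * expR (- eps * t).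
Proof.
have [eps eps0 eps_le] := exists_rate.
have [c c0 cbox] := weighted_box_norm; have [C C0 boxC] := norm_weighted_box.
exists eps => //; exists (c * C) => [|t z t0]; first exact: mulr_ge0.
have Cz0 : 0 <= C * `|z| by rewrite mulr_ge0.
have := weighted_box_exp eps_le t0 Cz0 (boxC z).
move/cbox => /(_ (mulr_ge0 Cz0 (expR_ge0 _))); by rewrite !mulrA.
Qed.

End CoupledSystem.

(** * Exponential decay and asymptotic stability *)

Section Stability.
Context {R : realType} {m : nat}.

Lemma linear_solution (B : 'M[R]_m) x0 :
  exists2 x, solution (fun x : 'cV[R]_m => B *m x) x & x 0 = x0.
Proof.
have dx (t : R) : is_derive t 1 (fun t : R => mx_exp (t *: B) *m x0)
    (B *m (mx_exp (t *: B) *m x0)).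
  apply: is_derive_eq (is_derive_mulmx (is_derive_mx_exp B t)
    (is_derive_cst x0 t (1 : R))) _.
  by rewrite mulmx0 addr0 mulmxA.
exists (fun t : R => mx_exp (t *: B) *m x0); last by rewrite mx_exp0 mul1mx.
split=> [|t _]; last exact: dx.
by apply: continuous_subspaceT => t; exact: is_derive_continuous (dx t).
Qed.

Lemma exp_decay_stable (B : 'M[R]_m) (eps C : R) : 0 < eps -> 0 <= C ->
  (forall (t : R) (z : 'cV[R]_m), 0 <= t ->
     `|mx_exp (t *: B) *m z| <= C * `|z| * expR (- eps * t)) ->
  globally_asymptotically_stable (fun x : 'cV[R]_m => B *m x).
Proof.
move=> eps0 C0 decay.
have solE x t : solution (fun x : 'cV[R]_m => B *m x) x -> 0 <= t ->
    x t = mx_exp (t *: B) *m x 0.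
  by move=> [xc xd] t0; exact: linear_ode_unique.
split=> [x0|e e0|x xsol].
- exact: linear_solution.
- have C1 : 0 < C + 1 by rewrite ltr_wpDl.
  exists (e / (C + 1)) => [|x xsol]; first exact: divr_gt0.
  rewrite ltr_pdivlMr// => x0e t t0; rewrite solE//.
  apply: le_lt_trans (decay _ _ t0) _; apply: le_lt_trans x0e.
  apply: (@le_trans _ _ (C * `|x 0|)).
    rewrite -[leRHS]mulr1 ler_wpM2l ?mulr_ge0// -expR0 ler_expR mulNr oppr_le0.
    by rewrite mulr_ge0// ltW.
  by rewrite mulrC ler_wpM2l// lerDl.
- apply/norm_cvg0P; apply: (@squeeze_cvgr _ _ _ _ (fun=> 0)
    (fun t => C * `|x 0| * expR (- (eps * t)))).
  + near=> t; have t0 : 0 <= t by near: t; exact: nbhs_pinfty_ge.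
    by rewrite normr_ge0/= solE// -mulNr; exact: decay.
  + exact: cvg_cst.
  + rewrite -[X in _ --> X](mulr0 (C * `|x 0|)); apply: cvgM; first exact: cvg_cst.
    apply: (cvg_comp (fun t => eps * t) (fun y => expR (- y))); last exact: cvgr_expR.
    by apply: gt0_cvgMry => //; exact: cvg_id.
Unshelve. all: by end_near. Qed.

End Stability.

Theorem corollary22 (R : realType) (n : nat) (N : 'I_n -> nat)
  (nu : forall j : 'I_n, 'cV[R]_(N j) -> R)
  (A : forall j : 'I_n, 'M[R]_(N j))
  (Delta : forall j k : 'I_n, 'M[R]_(N j, N k))
  (M lambda : 'I_n -> R)
  (nu_norm : forall j, vector_norm (nu j))
  (A_hurwitz : forall j, hurwitz (A j))
  (Delta_diag : forall j, Delta j j = 0)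
  (M_gt0 : forall j, 0 < M j)
  (lambda_gt0 : forall j, 0 < lambda j)
  (exp_bound : forall (j : 'I_n) (t : R), 0 <= t ->
     operator_norm (nu j) (nu j) (mx_exp (t *: A j))
       <= M j * expR (- lambda j * t)) :
  let G : 'M[R]_n := \matrix_(j, k) operator_norm (nu k) (nu j) (Delta j k) in
  let D : 'M[R]_n := diag_mx (\row_j (M j / lambda j)) in
  spectral_radius (D *m G) < 1 ->
  globally_asymptotically_stable
    (fun x : 'cV[R]_(\sum_j N j) =>
       (\mxdiag_j A j + \mxblock_(j, k) Delta j k) *m x).
Proof.
move=> G D rho_lt1.
(* The weights solve [w = 1 + D G w]; row [j] of this equation is the coupling
   condition [M_j (G w)_j = lambda_j (w_j - 1)]. *)
have [|w wE w_ge1] := positive_supersolution _ rho_lt1.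
  move=> j k; rewrite mul_diag_mx !mxE mulr_ge0 ?divr_ge0 ?(ltW (M_gt0 _)) ?(ltW (lambda_gt0 _))//.
  exact: operator_norm_ge0.
have coupling_small j : M j * (\sum_k operator_norm (nu k) (nu j) (Delta j k) * w k 0)
    <= lambda j * (w j 0 - 1).
  have -> : w j 0 - 1 = M j / lambda j *
      \sum_k operator_norm (nu k) (nu j) (Delta j k) * w k 0.
    rewrite {1}wE mxE -mulmxA mul_diag_mx !mxE [1 + _]addrC addrK.
    by congr (_ * _); apply: eq_bigr => k _; rewrite mxE.
  by rewrite mulrA [lambda j * _]mulrC divfK// gt_eqF.
have [eps eps0 [C C0 decay]] := mx_exp_decay nu_norm M_gt0 lambda_gt0 exp_bound
  w_ge1 coupling_small.
exact: exp_decay_stable eps0 C0 decay.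
Qed.
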